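(* Let $G$ be a finite abelian $p$-group ($p$ a prime) with $d(G)=2$. Let $\{K_1,K_2,\dots,K_s\}$ be the set of all maximal subgroups of $G$. Then $s=p+1$ and $$\mathrm{Gen}(G)=\{(x,y): x\in K_i,\ y\in K_j,\ i\neq j,\ \text{and } x,y\notin\Phi(G)\}.$$ Moreover, for any $x\in G\setminus\Phi(G)$, $|N_x|=\varphi(|G|)$.
   Context: $d(G)$ denotes the minimum size of a generating set of $G$. $\Phi(G)$ is the Frattini subgroup of $G$ (the intersection of all maximal subgroups of $G$). $\varphi$ is the Euler totient function. For a group $G$, $\mathrm{Gen}(G)=\{(x,y)\in G\times G : \langle x,y\rangle=G\}$, and for $x\in G$, $N_x=\{y\in G:\langle x,y\rangle=G\}$. In the displayed formula, the condition is that there exist indices $i\neq j$ with $x\in K_i$ and $y\in K_j$. *)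

(* Defs.v *)
From mathcomp Require Import all_boot fingroup pgroup gseries maximal abelian.

Set Implicit Arguments.
Unset Strict Implicit.
Unset Printing Implicit Defensive.

Local Open Scope group_scope.

Definition Gen (gT : finGroupType) (G : {group gT}) : {set gT * gT} :=
  [set xy in setX G G | <<[set xy.1; xy.2]>> == G :> {set gT}].

Definition gen_partners (gT : finGroupType) (G : {group gT}) (x : gT) :
    {set gT} :=
  [set y in G | <<[set x; y]>> == G :> {set gT}].

(* Main.v *)
Require Import Defs.
From mathcomp Require Import all_boot fingroup pgroup gseries maximal abelian.
From mathcomp Require Import quotient cyclic.

Set Implicit Arguments.
Unset Strict Implicit.
Unset Printing Implicit Defensive.

Local Open Scope group_scope.

(** An element x outside Phi(G) lies in exactly one maximal subgroup, namely
    Phi(G)<x>, because G / Phi(G) is elementary abelian of order p^2. Hence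
    x and y generate G if and only if y avoids that maximal subgroup, and the
    sets K \ Phi(G), for K maximal, partition G \ Phi(G); both cardinalities
    follow from |G : K| = p and |G : Phi(G)| = p^2. *)

(** In an abelian $p$-group $\Phi(G)$ is the subgroup ['Mho^1(G)] of $p$-th powers. Since
    $|\Omega_1(G)|\,|\mho^1(G)| = |G|$, its index is $|\Omega_1(G)|$, which is $p$ to the rank. *)
Lemma index_Phi_abelian (gT : finGroupType) (G : {group gT}) (p : nat) :
  prime p -> p.-group G -> abelian G -> #|G : 'Phi(G)| = (p ^ 'm(G))%N.
Proof.
move=> p_pr pG abG; apply/eqP.
rewrite -(eqn_pmul2l (cardG_gt0 'Phi(G))) Lagrange ?Phi_sub //.
rewrite /= (Phi_Mho pG abG) -(mul_card_Ohm_Mho_abelian 1 abG) mulnC.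
rewrite eqn_pmul2l ?cardG_gt0 // grank_abelian // (rank_pgroup pG).
by rewrite p_rank_abelian // -card_pgroup // (pgroupS (Ohm_sub 1 G)).
Qed.

Section FrattiniIndexSquare.

Variables (gT : finGroupType) (G : {group gT}) (p : nat).
Hypotheses (p_pr : prime p) (pG : p.-group G).
Hypothesis iPhi : #|G : 'Phi(G)| = (p ^ 2)%N.

Let nPhiG : G \subset 'N('Phi(G)) := normal_norm (Phi_normal G).

(** The image of [x] in the elementary abelian quotient $G/\Phi(G)$ is nontrivial, so it has order
    $p$. *)
Lemma card_Phi_cycle x : x \in G :\: 'Phi(G) ->
  #|'Phi(G) <*> <[x]>| = (p * #|'Phi(G)|)%N.
Proof.
case/setDP=> Gx nPhix; have nx : x \in 'N('Phi(G)) := subsetP nPhiG x Gx.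
have sXN : 'Phi(G) <*> <[x]> \subset 'N('Phi(G)).
  by rewrite join_subG normG cycle_subG.
rewrite -(Lagrange (joing_subl 'Phi(G) <[x]>)) -card_quotient //.
rewrite quotientYidl ?cycle_subG // quotient_cycle // -orderE mulnC.
rewrite (abelem_order_p (Phi_quotient_abelem pG)) ?mem_quotient //.
by apply: contraNneq nPhix; apply: coset_idr.
Qed.

Lemma maximal_Phi_cycle x : x \in G :\: 'Phi(G) ->
  maximal ('Phi(G) <*> <[x]>) G.
Proof.
move=> GPx; have [Gx _] := setDP GPx.
have sXG : 'Phi(G) <*> <[x]> \subset G by rewrite join_subG Phi_sub cycle_subG.
apply: (p_index_maximal sXG); suff ->: #|G : 'Phi(G) <*> <[x]>| = p by [].
apply/eqP; rewrite -(eqn_pmul2l (cardG_gt0 ('Phi(G) <*> <[x]>))) Lagrange //.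
by rewrite -(Lagrange (Phi_sub G)) iPhi card_Phi_cycle // -mulnA mulnCA.
Qed.

(** Every maximal subgroup contains $\Phi(G)$, so one containing [x] contains the maximal subgroup
    $\Phi(G)\langle x\rangle$ and equals it. *)
Lemma maximal_eq_Phi_cycle x (M : {group gT}) : x \in G :\: 'Phi(G) ->
  maximal M G -> (x \in M) = (M == 'Phi(G) <*> <[x]>)%G.
Proof.
move=> GPx maxM; apply/idP/eqP=> [Mx | ->]; last first.
  by rewrite -cycle_subG joing_subr.
have sXM : 'Phi(G) <*> <[x]> \subset M.
  by rewrite join_subG Phi_sub_max // cycle_subG.
have /maxgroupP[_ maxX] := maximal_Phi_cycle GPx.
by apply/val_inj/maxX; first exact: maxgroupp maxM.
Qed.

Lemma gen_pair_Phi_cycle x y : x \in G :\: 'Phi(G) -> y \in G ->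
  (<<[set x; y]>> == G :> {set gT}) = (y \notin 'Phi(G) <*> <[x]>).
Proof.
move=> GPx Gy; have [Gx _] := setDP GPx.
have maxX := maximal_Phi_cycle GPx.
have sXYG : <<[set x; y]>> \subset G by rewrite gen_subG subUset !sub1set Gx.
have [defG | [M maxM]] := maximal_exists sXYG.
  rewrite defG eqxx; apply/esym/negP=> Xy.
  have /andP[_ /negP[]] := maxgroupp maxX.
  rewrite -{1}defG gen_subG subUset !sub1set Xy andbT.
  by rewrite -cycle_subG joing_subr.
rewrite gen_subG subUset !sub1set => /andP[Mx My].
(* If [x] and [y] lie in a common maximal subgroup, it can only be the one attached to [x]. *)
have /eqP defM : M == ('Phi(G) <*> <[x]>)%G by rewrite -maximal_eq_Phi_cycle.
have -> : y \in 'Phi(G) <*> <[x]> by move: My; rewrite defM.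
apply/eqP=> defG; have /andP[_ /negP[]] := maxgroupp maxM.
by rewrite -defG gen_subG subUset !sub1set Mx.
Qed.

(** Elements of $\Phi(G)$ are non-generators: if [x] were one, [y] alone would generate $G$, and
    $\Phi(G)\langle y\rangle$ could not be proper. *)
Lemma gen_pair_notin_Phi x y : x \in G -> <<[set x; y]>> = G :> {set gT} ->
  x \notin 'Phi(G).
Proof.
move=> Gx defG; apply/negP=> Phix.
have Gy : y \in G by rewrite -defG mem_gen // set22.
have defGy : <[y]> = G.
  apply: Phi_nongen; apply/eqP; rewrite eqEsubset.
  rewrite join_subG Phi_sub sub1set Gy -{1}defG gen_subG subUset !sub1set.
  by rewrite (subsetP (joing_subl _ _)) //= mem_gen // !inE eqxx orbT.
have GPy : y \in G :\: 'Phi(G).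
  rewrite inE Gy andbT; apply/negP=> Phiy.
  have: #|G : 'Phi(G)| == 1%N by rewrite indexg_eq1 -{1}defGy cycle_subG.
  by rewrite iPhi muln_eq1 (gtn_eqF (prime_gt1 p_pr)).
have /andP[_ /negP[]] := maxgroupp (maximal_Phi_cycle GPy).
by rewrite -{1}defGy joing_subr.
Qed.

Lemma card_gen_partners x : x \in G :\: 'Phi(G) ->
  #|gen_partners G x| = totient #|G|.
Proof.
move=> GPx; have maxX := maximal_Phi_cycle GPx.
have -> : gen_partners G x = G :\: ('Phi(G) <*> <[x]>).
  apply/setP=> y; rewrite !inE; case Gy: (y \in G); rewrite ?andbF //= andbT.
  exact: gen_pair_Phi_cycle.
rewrite cardsDS ?(maxgroupp maxX) ?proper_sub ?(maxgroupp maxX) //.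
(* With $|\Phi(G)| = p^k$ the count is $p^{k+2} - p^{k+1} = (p-1)p^{k+1}$, the totient of $p^{k+2} =
   |G|$. *)
have [k oPhi] := p_natP (pgroupS (Phi_sub G) pG).
rewrite -(Lagrange (Phi_sub G)) iPhi card_Phi_cycle // oPhi -expnD -expnS.
rewrite addn2 totient_pfactor //= [(p ^ k.+2)%N]expnS.
by rewrite -{2}[(p ^ k.+1)%N]mul1n -mulnBl subn1.
Qed.

Lemma card_maximal : #|[set H : {group gT} | maximal H G]| = p.+1.
Proof.
have cardD (M : {group gT}) :
  maximal M G -> #|M :\: 'Phi(G)| = (p.-1 * #|'Phi(G)|)%N.
  move=> maxM; rewrite cardsDS ?Phi_sub_max // -subn1 mulnBl mul1n.
  congr (_ - _)%N; apply/eqP.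
  rewrite -(eqn_pmul2r (prime_gt0 p_pr)) -{1}(p_maximal_index pG maxM).
  rewrite Lagrange ?proper_sub ?(maxgroupp maxM) //.
  by rewrite -(Lagrange (Phi_sub G)) iPhi mulnC mulnAC.
set maxs := [set H : {group gT} | maximal H G]; pose D := G :\: 'Phi(G).
(* Double counting of the pairs $(M, x)$ with [M] maximal and [x] in [M] outside $\Phi(G)$: each [x]
   in [D] occurs with exactly one [M]. *)
have: #|D| = (#|maxs| * (p.-1 * #|'Phi(G)|))%N.
  rewrite -sum_nat_const.
  rewrite (eq_bigr (fun M : {group gT} => \sum_(x in D | x \in M) 1)%N).
    rewrite (exchange_big_dep (mem D)) //= => [|M x _ /andP[] //].
    rewrite -sum1_card; apply: eq_bigr => x Dx.
    rewrite (big_pred1 ('Phi(G) <*> <[x]>)%G) // => M.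
    rewrite /= inE Dx /=; have [maxM | nmaxM] := boolP (maximal M G).
      exact: maximal_eq_Phi_cycle.
    by apply/esym/(contraNF _ nmaxM)=> /eqP->; apply: maximal_Phi_cycle.
  move=> M; rewrite inE => maxM; rewrite -(cardD M maxM) -sum1_card.
  apply: eq_bigl => x; rewrite !inE; case Mx: (x \in M); rewrite ?andbF //=.
  by rewrite (subsetP (proper_sub (maxgroupp maxM)) x Mx) !andbT.
(* Since $|D| = (p^2-1)|\Phi(G)|$ and $p^2-1 = (p-1)(p+1)$, cancelling $(p-1)|\Phi(G)|$ leaves
   $p+1$. *)
rewrite /D cardsDS ?Phi_sub // -(Lagrange (Phi_sub G)) iPhi.
rewrite -[X in (_ - X)%N]muln1 -mulnBr mulnC mulnA => /eqP.
rewrite eqn_pmul2r ?cardG_gt0 // -(exp1n 2) subn_sqr subn1 addn1 mulnC.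
by rewrite eqn_pmul2r => [/eqP<- //|]; rewrite -subn1 subn_gt0 prime_gt1.
Qed.

End FrattiniIndexSquare.

Theorem proposition3p1 (gT : finGroupType) (G : {group gT}) (p : nat)
    (p_pr : prime p) (pG : p.-group G) (abG : abelian G)
    (dG : 'm(G) = 2)
    (s : nat) (K : 'I_s -> {group gT}) (injK : injective K)
    (defK : [set K i | i : 'I_s] = [set H : {group gT} | maximal H G]) :
  [/\ s = p.+1,
      Gen G = [set xy : gT * gT |
                [&& [exists i, exists j,
                       [&& i != j, xy.1 \in K i & xy.2 \in K j]],
                    xy.1 \notin 'Phi(G) & xy.2 \notin 'Phi(G)]]
    & forall x : gT, x \in G :\: 'Phi(G) ->
        #|gen_partners G x| = totient #|G| ].
Proof.
have iPhi : #|G : 'Phi(G)| = (p ^ 2)%N by rewrite -dG; apply: index_Phi_abelian.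
have maxK i : maximal (K i) G.
  have: K i \in [set K i | i : 'I_s] by apply: imset_f.
  by rewrite defK inE.
have sKG i : K i \subset G := proper_sub (maxgroupp (maxK i)).
have exK x : x \in G :\: 'Phi(G) -> exists i, K i = ('Phi(G) <*> <[x]>)%G.
  move=> GPx.
  have: ('Phi(G) <*> <[x]>)%G \in [set K i | i : 'I_s].
    by rewrite defK inE (maximal_Phi_cycle p_pr pG iPhi).
  by case/imsetP=> i _ ->; exists i.
split; last by move=> x; apply: (card_gen_partners p_pr pG iPhi).
  by rewrite -(card_maximal p_pr pG iPhi) -defK card_imset ?card_ord.
apply/setP=> -[x y]; rewrite !inE /=; apply/idP/idP.
  case/andP=> /andP[Gx Gy] gen_xy.
  have nPhix : x \notin 'Phi(G).
    by apply: (gen_pair_notin_Phi p_pr pG iPhi) (eqP gen_xy).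
  have nPhiy : y \notin 'Phi(G).
    apply: (gen_pair_notin_Phi p_pr pG iPhi (y := x)) => //.
    by rewrite setUC; apply/eqP.
  have GPx : x \in G :\: 'Phi(G) by rewrite inE nPhix.
  have GPy : y \in G :\: 'Phi(G) by rewrite inE nPhiy.
  rewrite nPhix nPhiy !andbT.
  have [[i Ki] [j Kj]] := (exK x GPx, exK y GPy).
  apply/existsP; exists i; apply/existsP; exists j.
  rewrite (maximal_eq_Phi_cycle p_pr pG iPhi GPx) // Ki eqxx.
  rewrite (maximal_eq_Phi_cycle p_pr pG iPhi GPy) // Kj eqxx !andbT.
  move: gen_xy; rewrite (gen_pair_Phi_cycle p_pr pG iPhi) //.
  (* If the two indices agreed, [y] would lie in $\Phi(G)\langle x\rangle$, against generation. *)
  apply: contraNneq => eq_ij.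
  have -> : 'Phi(G) <*> <[x]> = K j by rewrite -eq_ij Ki.
  by rewrite (maximal_eq_Phi_cycle p_pr pG iPhi GPy) // Kj.
case/and3P=> /existsP[i /existsP[j /and3P[neq_ij Kix Kjy]]] nPhix nPhiy.
have Gx := subsetP (sKG i) x Kix; have Gy := subsetP (sKG j) y Kjy.
have GPx : x \in G :\: 'Phi(G) by rewrite inE nPhix.
have GPy : y \in G :\: 'Phi(G) by rewrite inE nPhiy.
rewrite Gx Gy (gen_pair_Phi_cycle p_pr pG iPhi) //=.
(* If [y] were in $\Phi(G)\langle x\rangle$, which is [K i], then [K i] and [K j] would both be the
   unique maximal subgroup containing [y]. *)
apply: contra neq_ij => Xy; rewrite -(inj_eq injK).
move: Kix; rewrite (maximal_eq_Phi_cycle p_pr pG iPhi GPx) // => /eqP Ki.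
have: y \in K i by rewrite Ki.
move: Kjy; rewrite !(maximal_eq_Phi_cycle p_pr pG iPhi GPy) //.
by move=> /eqP-> /eqP->.
Qed.
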